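(* Let $\mu$ be a partition of $n$ and let $\sigma$ be a standard tableau of shape $\mu$. Then, in $\mathbb Q(q,t)$, $$\frac{\prod_{x\in Y_\mu}(1-q^{1+a(x)}t^{-l(x)})(1-q^{-a(x)}t^{1+l(x)})}{(1-q)^n(1-t)^n\cdot\Omega[B_\mu(q^{-1},t^{-1})]^0}\cdot\Gamma_\sigma(q,t)=\prod_{k=1}^n\mathrm c_{\sigma(k)}(q,t).$$
   Context: The Young diagram of $\mu$ is $Y_\mu=\{(i,j)\in\mathbb Z^2:0\le j\le\ell(\mu)-1,\ 0\le i\le\mu_{j+1}-1\}$ (first coordinate: column; second: row; rows stacked upwards). For $x\in Y_\mu$, $a(x)$ (arm) is the number of boxes of $Y_\mu$ strictly to the right of $x$ in its row, $l(x)$ (leg) the number strictly above $x$ in its column. $B_\mu(q,t)=\sum_{(r,s)\in Y_\mu}q^rt^s$ and $B_\emptyset=0$. A standard tableau $\sigma$ of shape $\mu$ is a bijective filling of $Y_\mu$ by $1,\dots,n$ increasing upwards and to the right; $(c_\sigma(k),r_\sigma(k))$ is the box containing $k$; $\sigma(k)$, $0\le k\le n$, also denotes the partition formed by the boxes containing $1,\dots,k$. For $E=\sum a_{i,j}q^it^j\in\mathbb Z[q^{\pm1},t^{\pm1}]$ put $\Omega[E]=\prod(1-q^it^j)^{a_{i,j}}$ and $\Omega[E]^0=\Omega[E-a_{0,0}]$ (with $\Omega[0]^0=1$). Define $$\Gamma_\sigma(q,t)=\prod_{k=1}^n\Omega\big[(1-q-t+qt)B_{\sigma(k-1)}(q,t)q^{-c_\sigma(k)}t^{-r_\sigma(k)}\big]^0.$$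 Let $\mathrm R_k$, respectively $\mathrm C_k$, be the set of boxes of $Y_{\sigma(k)}$ in the same row, respectively column, as the box $p_k=\sigma(k)\setminus\sigma(k-1)$, excluding $p_k$ itself. Let $a_k(x),l_k(x)$ be the arm and leg length of $x$ in $Y_{\sigma(k)}$. Define $$\mathrm c_{\sigma(k)}(q,t)=\prod_{x\in\mathrm R_k}\frac{1-q^{1+a_k(x)}t^{-l_k(x)}}{1-q^{1+a_{k-1}(x)}t^{-l_{k-1}(x)}}\cdot\prod_{x\in\mathrm C_k}\frac{1-q^{-a_k(x)}t^{1+l_k(x)}}{1-q^{-a_{k-1}(x)}t^{1+l_{k-1}(x)}}.$$ *)

(* Defs.v *)
From HB Require Import structures.
From mathcomp Require Import all_boot all_order all_algebra.
From mathcomp Require Import finmap.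
From mathcomp.multinomials Require Import monalg.

Set Implicit Arguments.
Unset Strict Implicit.
Unset Printing Implicit Defensive.

Import GRing.Theory.
Local Open Scope fset_scope.
Local Open Scope ring_scope.

(* Z[q^{+-1}, t^{+-1}]: finitely supported functions on Z^2 with the
   convolution product; the exponent (i, j) stands for q^i t^j. The exponents
   are not a [monomType], because of its axiom [unitm], so that the product of
   [{malg int[_]}] is not available. *)
Definition laurent : Type := {malg int[(int * int)%type]}.
HB.instance Definition _ := GRing.Zmodule.on laurent.

Section LaurentRing.
Implicit Types E F G : laurent.

Definition lmonom (i j : int) : laurent := << (1 : int) *g (i, j) >>.

Definition lone : laurent := lmonom 0 0.

Definition lmul E F : laurent :=
  \sum_(k <- msupp E) \sum_(l <- msupp F) << E@_k * F@_l *g k + l >>.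

Lemma lmulw (A B : {fset (int * int)%type}) E F :
    msupp E `<=` A -> msupp F `<=` B ->
  lmul E F = \sum_(k <- A) \sum_(l <- B) << E@_k * F@_l *g k + l >>.
Proof.
move=> leA leB; rewrite /lmul (big_fset_incl _ leA) /=.
  apply/eq_bigr=> k _; apply/big_fset_incl => // l _ /mcoeff_outdom ->.
  by rewrite mulr0 monalgU0.
move=> k _ /mcoeff_outdom Ek.
by rewrite big1 => // l _; rewrite Ek mul0r monalgU0.
Qed.

Lemma lmulC : commutative lmul.
Proof.
move=> E F; rewrite /lmul exchange_big; apply/eq_bigr=> k _.
by apply/eq_bigr=> l _; rewrite mulrC addrC.
Qed.

Lemma lmulDl : left_distributive lmul +%R.
Proof.
move=> E F G; rewrite (lmulw (fsubsetUl (msupp E) (msupp F)) (fsubset_refl _)).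
rewrite (lmulw (fsubsetUr (msupp E) (msupp F)) (fsubset_refl _)).
rewrite (lmulw (msuppD_le _ _) (fsubset_refl _)).
rewrite -big_split /=; apply/eq_bigr=> k _.
rewrite -big_split /=; apply/eq_bigr=> l _.
by rewrite mcoeffD mulrDl monalgUD.
Qed.

Lemma lmulDr : right_distributive lmul +%R.
Proof. by move=> E F G; rewrite lmulC lmulDl !(lmulC E). Qed.

Lemma lmul0l : left_zero 0 lmul.
Proof. by move=> E; rewrite /lmul msupp0 big_seq_fset0. Qed.

Lemma lmul0r : right_zero 0 lmul.
Proof. by move=> E; rewrite lmulC lmul0l. Qed.

Lemma lmulUU (a b : int) (k l : (int * int)%type) :
  lmul << a *g k >> << b *g l >> = << a * b *g k + l >>.
Proof. by rewrite (lmulw msuppU_le msuppU_le) !big_seq_fset1 !mcoeffUU. Qed.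

Lemma lmul1l : left_id lone lmul.
Proof.
move=> E; rewrite (lmulw msuppU_le (fsubset_refl _)) big_seq_fset1.
rewrite [RHS]monalgE; apply/eq_bigr=> k _.
by rewrite mcoeffUU mul1r add0r.
Qed.

Lemma lmulA : associative lmul.
Proof.
have := (lmulDl, lmulDr, lmul0l, lmul0r, lmulUU).
move: lmul => op [[[[opDl opDr] op0l] op0r] opU] E F G.
have suml r f A : op (\sum_(k <- r) f k) A = \sum_(k <- r) op (f k) A.
  exact: (big_morph (op^~ A) (fun _ _ => opDl _ _ _) (op0l _)).
have sumr r f A : op A (\sum_(k <- r) f k) = \sum_(k <- r) op A (f k).
  exact: (big_morph (op A) (fun _ _ => opDr _ _ _) (op0r _)).
rewrite [E]monalgE !suml; apply/eq_bigr=> k _.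
rewrite [F]monalgE !(suml, sumr); apply/eq_bigr=> l _.
rewrite [G]monalgE !sumr; apply/eq_bigr=> m _.
by rewrite !opU mulrA addrA.
Qed.

Lemma lone_neq0 : lone != 0.
Proof. by rewrite monalgU_eq0. Qed.

HB.instance Definition _ := GRing.Zmodule_isComNzRing.Build laurent
  lmulA lmulC lmul1l lmulDl lone_neq0.
End LaurentRing.

Definition lq : laurent := lmonom 1 0.
Definition lt : laurent := lmonom 0 1.

(* E(q^{-1}, t^{-1}) *)
Definition linv (E : laurent) : laurent :=
  \sum_(k <- msupp E) << E@_k *g - k >>.

(* Q(q,t), as the fraction field of Q[q][t] *)
Definition Qqt : fieldType := {fraction {poly {poly rat}}}.
Definition q : Qqt := FracField.tofrac ('X%:P).
Definition t : Qqt := FracField.tofrac 'X.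

(* The factor of exponent (0, 0) is 0 ^ a_{0,0}: by the library's convention on
   inverses it is 0 when a_{0,0} <> 0, and 1 when a_{0,0} = 0. *)
Definition Omega (E : laurent) : Qqt :=
  \prod_(k <- msupp E) (1 - q ^ k.1 * t ^ k.2) ^ E@_k.

Definition Omega0 (E : laurent) : Qqt :=
  Omega (E - << E@_(0, 0) *g (0, 0) >>).

(* Partitions are identified with their lists of nonzero parts. *)
Definition is_partition (n : nat) (mu : seq nat) : bool :=
  [&& sorted geq mu, 0%N \notin mu & sumn mu == n].

(* A box is a pair (column, row). *)
Notation box := (nat * nat)%type.

Definition Young (mu : seq nat) : {fset box} :=
  [fset x in [seq (i, j) | j <- iota 0 (size mu), i <- iota 0 (nth 0%N mu j)]].

Definition arm (D : {fset box}) (x : box) : nat :=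
  #|` [fset y in D | (y.2 == x.2) && (x.1 < y.1)%N] |.

Definition leg (D : {fset box}) (x : box) : nat :=
  #|` [fset y in D | (y.1 == x.1) && (x.2 < y.2)%N] |.

Definition B (D : {fset box}) : laurent := \sum_(x <- D) lmonom x.1 x.2.

(* Only the values of s on the diagram of mu are meaningful. *)
Definition standard_tableau (n : nat) (mu : seq nat) (s : box -> nat) : Prop :=
  [/\ {in Young mu &, injective s},
      [fset s x | x in Young mu] = [fset k in iota 1 n],
      {in Young mu &, forall x y, x.2 = y.2 -> (x.1 < y.1)%N -> (s x < s y)%N}
    & {in Young mu &, forall x y, x.1 = y.1 -> (x.2 < y.2)%N -> (s x < s y)%N}].

Section Tableau.
Variables (mu : seq nat) (s : box -> nat).

(* The partition sigma(k), given by its diagram. *)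
Definition subshape (k : nat) : {fset box} :=
  [fset x in Young mu | (s x <= k)%N].

(* The box (c_sigma(k), r_sigma(k)), which is unique for 1 <= k <= n; the
   default value (0, 0) is only used for other values of k. *)
Definition box_of (k : nat) : box :=
  head (0%N, 0%N) [seq x <- Young mu | s x == k].

Definition Gamma (n : nat) : Qqt :=
  \prod_(1 <= k < n.+1)
    Omega0 ((1 - lq - lt + lq * lt) * B (subshape k.-1)
            * lmonom (- (box_of k).1%:Z) (- (box_of k).2%:Z)).

Definition row_boxes (k : nat) : {fset box} :=
  [fset x in subshape k | (x.2 == (box_of k).2) && (x != box_of k)].

Definition col_boxes (k : nat) : {fset box} :=
  [fset x in subshape k | (x.1 == (box_of k).1) && (x != box_of k)].

Definition c_coef (k : nat) : Qqt :=
  (\prod_(x <- row_boxes k)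
    ((1 - q ^ (1 + (arm (subshape k) x)%:Z) * t ^ (- (leg (subshape k) x)%:Z))
     / (1 - q ^ (1 + (arm (subshape k.-1) x)%:Z)
            * t ^ (- (leg (subshape k.-1) x)%:Z))))
  * \prod_(x <- col_boxes k)
    ((1 - q ^ (- (arm (subshape k) x)%:Z) * t ^ (1 + (leg (subshape k) x)%:Z))
     / (1 - q ^ (- (arm (subshape k.-1) x)%:Z)
            * t ^ (1 + (leg (subshape k.-1) x)%:Z))).

End Tableau.

(* Main.v *)
(* Let D = Y_{sigma(k-1)} and let (c, r) = p_k be the box added to it. Adding p_k
   changes the hooks only in the row and the column of p_k, so dividing the k-th
   stage of the identity by the previous one leaves
     Omega[(1-q)(1-t) B_D q^{-c} t^{-r}]^0
       = Omega[q^{-c} t^{-r}]^0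
         * prod_{x in R_k} (1 - q^{-a_{k-1}} t^{1+l_{k-1}}) / (1 - q^{-a_k} t^{1+l_k})
         * prod_{x in C_k} (1 - q^{1+a_{k-1}} t^{-l_{k-1}}) / (1 - q^{1+a_k} t^{-l_k}).
   With h_i the height of column i and w_j the width of row j of D, geometric
   summation over the columns i < c and, to the right of them, over the rows
   j < r gives
     (1-q)(1-t) B_D = 1 - q^c t^r + sum_{i<c} (q^{i+1} - q^i) t^{h_i}
                                  + sum_{j<r} q^{w_j} (t^{j+1} - t^j).
   Shifting by q^{-c} t^{-r} turns - q^c t^r into the constant -1, which
   Omega[.]^0 discards, and the two sums into the products over R_k and C_k. *)
Require Import Defs.
From mathcomp Require Import all_boot all_order all_algebra.
From mathcomp Require Import finmap.
From mathcomp.multinomials Require Import monalg.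
From mathcomp Require Import zify ring.

Set Implicit Arguments.
Unset Strict Implicit.
Unset Printing Implicit Defensive.

Import GRing.Theory.
Local Open Scope fset_scope.
Local Open Scope ring_scope.

(** * Monomials in Q(q,t) and the multiplicativity of [Omega0] *)

Lemma q_neq0 : q != 0.
Proof. by rewrite tofrac_eq0 polyC_eq0 polyX_eq0. Qed.

Lemma t_neq0 : t != 0.
Proof. by rewrite tofrac_eq0 polyX_eq0. Qed.

(** The degree in [t] recovers the exponent of [t]; the degree in [q] of the leading coefficient
    then recovers that of [q]. *)
Lemma qt_monom_inj (a b c d : nat) :
  q ^+ a * t ^+ b = q ^+ c * t ^+ d -> (a, b) = (c, d).
Proof.
rewrite -!rmorphXn -!rmorphM => /eqP; rewrite tofrac_eq => /eqP E.
have Xn0 n : 'X^n != 0 :> {poly rat} by rewrite -size_poly_gt0 size_polyXn.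
have sz n m : size (('X^n)%:P * 'X^m : {poly {poly rat}}) = m.+1.
  by rewrite size_Cmul ?size_polyXn.
have bd : b = d.
  by move/(congr1 (size : {poly {poly rat}} -> nat)): E; rewrite !sz => -[].
move/(congr1 (fun p : {poly {poly rat}} => p`_d)): E.
rewrite bd !coefCM !coefXn eqxx !mulr1 => /(congr1 (size : {poly rat} -> nat)).
by rewrite !size_polyXn => -[->].
Qed.

Local Opaque q t.

Definition qt (k : int * int) : Qqt := q ^ k.1 * t ^ k.2.

Lemma qtD k l : qt (k + l) = qt k * qt l.
Proof. by rewrite /qt (expfzDr _ _ q_neq0) (expfzDr _ _ t_neq0) mulrACA. Qed.

(** Multiplying by the monomial of the negative parts reduces this to [qt_monom_inj]. Hence no
    factor of [Omega0] at a nonzero exponent vanishes. *)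
Lemma qt_eq1 k : (qt k == 1) = (k == 0).
Proof.
apply/eqP/eqP=> [|->]; last by rewrite /qt !expr0z mulr1.
have diffn (i : int) : {ab : nat * nat | i = ab.1%:Z - ab.2%:Z}.
  case: i => m; first by exists (m, 0%N); rewrite subr0.
  by exists (0%N, m.+1); rewrite sub0r NegzE.
case: k => i j; have [[a c] /= ->] := diffn i; have [[b d] /= ->] := diffn j.
move=> E; have: qt (a%:Z, b%:Z) = qt (c%:Z, d%:Z).
  rewrite -[RHS]mul1r -{}E -qtD; congr qt.
  rewrite -[RHS]/(a%:Z - c%:Z + c%:Z, b%:Z - d%:Z + d%:Z).
  by rewrite !subrK.
by move/qt_monom_inj=> [-> ->]; rewrite !subrr.
Qed.

Lemma qt_factor_neq0 k : k != 0 -> 1 - qt k != 0.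
Proof. by move=> k0; rewrite subr_eq0 eq_sym qt_eq1. Qed.

(** Exponents outside the support only contribute powers 0, so elements with different supports can
    be compared over a common index set. *)
Lemma Omega0E (A : {fset (int * int)%type}) (E : laurent) :
    msupp E `<=` A ->
  Omega0 E = \prod_(k <- A | k != 0) (1 - qt k) ^ E@_k.
Proof.
move=> sEA; rewrite /Omega0 /Omega; set F : laurent := E - _.
have FE k : F@_k = if k == 0 then 0 else E@_k.
  rewrite mcoeffB mcoeffU eq_sym; case: eqP => [->|_]; last by rewrite subr0.
  exact: subrr.
rewrite (@big_fset_incl _ _ _ _ (msupp F) A); last first.
- by move=> k _ /mcoeff_outdom ->; rewrite expr0z.
- apply/fsubsetP => k; rewrite -mcoeff_neq0 FE; case: ifP => _.
    by rewrite eqxx.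
  by rewrite mcoeff_neq0 => /(fsubsetP sEA).
rewrite [RHS]big_mkcond /=; apply: eq_bigr => k _.
by rewrite FE; case: eqP => //=; rewrite expr0z.
Qed.

(** Integer powers add because discarding the exponent 0 leaves only nonzero bases. *)
Lemma Omega0D (E F : laurent) : Omega0 (E + F) = Omega0 E * Omega0 F.
Proof.
rewrite (Omega0E (msuppD_le E F)) (Omega0E (fsubsetUl (msupp E) (msupp F))).
rewrite (Omega0E (fsubsetUr (msupp E) (msupp F))) -big_split /=.
by apply: eq_bigr => k k0; rewrite mcoeffD expfzDr ?qt_factor_neq0.
Qed.

Lemma Omega0_0 : Omega0 0 = 1.
Proof.
by rewrite (@Omega0E fset0) ?msupp0 ?fsubset_refl // big_mkcond big_seq_fset0.
Qed.

Lemma Omega0_neq0 E : Omega0 E != 0.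
Proof.
apply/eqP=> E0; have /eqP := Omega0D E (- E).
by rewrite subrr Omega0_0 E0 mul0r oner_eq0.
Qed.

Lemma Omega0N E : Omega0 (- E) = (Omega0 E)^-1.
Proof.
apply: (mulfI (Omega0_neq0 E)).
by rewrite -Omega0D subrr Omega0_0 divff ?Omega0_neq0.
Qed.

Lemma Omega0_sum (I : Type) (r : seq I) (P : pred I) (F : I -> laurent) :
  Omega0 (\sum_(i <- r | P i) F i) = \prod_(i <- r | P i) Omega0 (F i).
Proof. exact: (big_morph _ Omega0D Omega0_0). Qed.

Lemma Omega0_monom i j :
  Omega0 (lmonom i j) = if (i, j) == 0 then 1 else 1 - q ^ i * t ^ j.
Proof.
rewrite (Omega0E msuppU_le) big_mkcond big_seq_fset1 /= mcoeffUU.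
by case: eqP => //=; rewrite expr1z.
Qed.

(** * Monomials and inversion of exponents in the Laurent ring *)

Lemma lmonom0 : lmonom 0 0 = 1.
Proof. by []. Qed.

Lemma lmonomM i j k l : lmonom i j * lmonom k l = lmonom (i + k) (j + l).
Proof. by rewrite /GRing.mul /= /lmonom lmulUU. Qed.

Lemma linvE (A : {fset (int * int)%type}) (E : laurent) :
  msupp E `<=` A -> linv E = \sum_(k <- A) << E@_k *g - k >>.
Proof.
move=> sEA; rewrite /linv (big_fset_incl _ sEA) //= => k _ /mcoeff_outdom ->.
exact: monalgU0.
Qed.

Lemma linvD E F : linv (E + F) = linv E + linv F.
Proof.
rewrite (linvE (msuppD_le E F)) (linvE (fsubsetUl (msupp E) (msupp F))).
rewrite (linvE (fsubsetUr (msupp E) (msupp F))) -big_split /=.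
by apply: eq_bigr => k _; rewrite mcoeffD monalgUD.
Qed.

Lemma linv0 : linv 0 = 0.
Proof. by rewrite /linv msupp0 big_seq_fset0. Qed.

Lemma linv_monom i j : linv (lmonom i j) = lmonom (- i) (- j).
Proof. by rewrite (linvE msuppU_le) big_seq_fset1 mcoeffUU. Qed.

Local Opaque lq lt lmul lmonom.

(** * Boxes of a diagram *)

Lemma big_fset_cond_seq (R : Type) (idx : R) (op : Monoid.com_law idx)
    (K : choiceType) (A : {fset K}) (P : pred K) (r : seq K) (F : K -> R) :
    uniq r -> (forall x, (x \in r) = (x \in A) && P x) ->
  \big[op/idx]_(x <- A | P x) F x = \big[op/idx]_(x <- r) F x.
Proof.
move=> ur rE; rewrite -big_filter; apply: perm_big.
apply: uniq_perm => // [|x]; first by rewrite filter_uniq ?fset_uniq.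
by rewrite mem_filter rE andbC.
Qed.

Lemma card_fset_cond (K : choiceType) (A : {fset K}) (P : pred K) :
  #|` [fset x in A | P x]| = (\sum_(x <- A | P x) 1)%N.
Proof. by rewrite [RHS]big_fset_condE sum1_size. Qed.

Definition downset (D : {fset nat * nat}) : Prop :=
  forall x y : nat * nat, (x.1 <= y.1)%N -> (x.2 <= y.2)%N -> y \in D -> x \in D.

Definition width (D : {fset nat * nat}) (j : nat) : nat :=
  #|` [fset y in D | y.2 == j]|.

Definition height (D : {fset nat * nat}) (i : nat) : nat :=
  #|` [fset y in D | y.1 == i]|.

(** Since [P] holds only inside the finite set [A], some index fails; the least such index is the
    length. *)
Lemma initial_segment (P : pred nat) (A : {fset nat}) :
    (forall i, P i -> i \in A) ->
    (forall i j, (i <= j)%N -> P j -> P i) ->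
  exists n, P =1 (fun i => (i < n)%N).
Proof.
move=> PA dP.
have [|n Pn minn] := @ex_minnP (fun i => ~~ P i).
  exists (\max_(i <- A) i).+1; apply/negP => /PA mA.
  by have := leq_bigmax_seq (P := xpredT) (F := id) _ mA isT; rewrite ltnn.
exists n => i; apply/idP/idP => [Pi|]; last first.
  by apply: contraLR => /minn; rewrite leqNgt.
by rewrite ltnNge; apply: contra Pn => /dP; apply.
Qed.

Section Downset.
Variable D : {fset nat * nat}.
Hypothesis downD : downset D.

(** A row of a downset is an initial segment, whose length is its cardinality. Membership thus
    becomes a linear inequality. *)
Lemma mem_width i j : ((i, j) \in D) = (i < width D j)%N.
Proof.
have [|i1 i2 le12 /(downD _ _)->//|w wE] :=
    @initial_segment (fun i => (i, j) \in D) [fset x.1 | x in D].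
  by move=> k kD; apply/imfsetP; exists (k, j).
suff -> : width D j = w by exact: wE.
rewrite /width card_fset_cond.
rewrite (@big_fset_cond_seq _ _ _ _ _ _ [seq (k, j) | k <- iota 0 w]).
- by rewrite sum1_size size_map size_iota.
- by rewrite map_inj_uniq ?iota_uniq // => k l [].
case=> k l /=; apply/mapP/andP => [[k' + [-> ->]]|[klD /eqP jl]].
  by rewrite mem_iota /= => k'w; rewrite wE eqxx.
by exists k; [rewrite mem_iota /= -wE -jl|rewrite jl].
Qed.

Lemma mem_height i j : ((i, j) \in D) = (j < height D i)%N.
Proof.
have [|j1 j2 le12 /(downD _ _)->//|h hE] :=
    @initial_segment (fun j => (i, j) \in D) [fset x.2 | x in D].
  by move=> k kD; apply/imfsetP; exists (i, k).
suff -> : height D i = h by exact: hE.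
rewrite /height card_fset_cond.
rewrite (@big_fset_cond_seq _ _ _ _ _ _ [seq (i, k) | k <- iota 0 h]).
- by rewrite sum1_size size_map size_iota.
- by rewrite map_inj_uniq ?iota_uniq // => k l [].
case=> k l /=; apply/mapP/andP => [[k' + [-> ->]]|[klD /eqP jl]].
  by rewrite mem_iota /= => k'w; rewrite hE eqxx.
by exists l; [rewrite mem_iota /= -hE -jl|rewrite jl].
Qed.

(** Truncated subtraction makes this valid outside [D] too, where both sides are 0; [hook_corner]
    uses it at the new box. *)
Lemma arm_width x : arm D x = (width D x.2 - x.1.+1)%N.
Proof.
rewrite /arm card_fset_cond.
rewrite (@big_fset_cond_seq _ _ _ _ _ _
           [seq (k, x.2) | k <- iota x.1.+1 (width D x.2 - x.1.+1)]).
- by rewrite sum1_size size_map size_iota.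
- by rewrite map_inj_uniq ?iota_uniq // => k l [].
case=> k l /=; apply/mapP/and3P => [[k' + [-> ->]]|[klD /eqP lx xk]].
  by rewrite mem_iota /= mem_width => kw; rewrite eqxx; split=> //; lia.
by exists k; [move: klD; rewrite mem_iota mem_width lx; lia|rewrite lx].
Qed.

Lemma leg_height x : leg D x = (height D x.1 - x.2.+1)%N.
Proof.
rewrite /leg card_fset_cond.
rewrite (@big_fset_cond_seq _ _ _ _ _ _
           [seq (x.1, k) | k <- iota x.2.+1 (height D x.1 - x.2.+1)]).
- by rewrite sum1_size size_map size_iota.
- by rewrite map_inj_uniq ?iota_uniq // => k l [].
case=> k l /=; apply/mapP/and3P => [[k' + [-> ->]]|[klD /eqP lx xk]].
  by rewrite mem_iota /= mem_height => kw; rewrite eqxx; split=> //; lia.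
by exists l; [move: klD; rewrite mem_iota mem_height lx; lia|rewrite lx].
Qed.

End Downset.

Lemma arm_U1 (D : {fset nat * nat}) (p x : nat * nat) : p \notin D ->
  arm (p |` D) x = (((p.2 == x.2) && (x.1 < p.1)) + arm D x)%N.
Proof.
move=> pD; rewrite /arm !card_fset_cond big_mkcond big_fsetU1 //= -big_mkcond.
by case: ifP.
Qed.

Lemma leg_U1 (D : {fset nat * nat}) (p x : nat * nat) : p \notin D ->
  leg (p |` D) x = (((p.1 == x.1) && (x.2 < p.2)) + leg D x)%N.
Proof.
move=> pD; rewrite /leg !card_fset_cond big_mkcond big_fsetU1 //= -big_mkcond.
by case: ifP.
Qed.

(** Full columns left of [c] are summed vertically, row segments starting at [c] horizontally. The
    leftovers [1 - x ^+ c] and [x ^+ c * (1 - y ^+ r)] add up to [1 - x ^+ c * y ^+ r]. *)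
Lemma geometric_cells (R : comNzRingType) (x y : R) (c r : nat) (h w : nat -> nat) :
    (forall j, (j < r)%N -> (c <= w j)%N) ->
  (1 - x - y + x * y)
    * (\sum_(0 <= i < c) \sum_(0 <= j < h i) x ^+ i * y ^+ j
       + \sum_(0 <= j < r) \sum_(c <= i < w j) x ^+ i * y ^+ j)
  = 1 - x ^+ c * y ^+ r
    + \sum_(0 <= i < c) (x ^+ i.+1 * y ^+ h i - x ^+ i * y ^+ h i)
    + \sum_(0 <= j < r) (x ^+ w j * y ^+ j.+1 - x ^+ w j * y ^+ j).
Proof.
move=> cw.
have geom (z : R) a b : (a <= b)%N ->
    (1 - z) * (\sum_(a <= i < b) z ^+ i) = z ^+ a - z ^+ b.
  move=> /(telescope_sumr (GRing.exp z)) E; rewrite mulr_sumr -[RHS]opprB -{}E.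
  by rewrite -sumrN; apply: eq_bigr => i _; rewrite exprS; ring.
have left_sum : (1 - x) * (1 - y)
      * (\sum_(0 <= i < c) \sum_(0 <= j < h i) x ^+ i * y ^+ j)
    = 1 - x ^+ c
      + \sum_(0 <= i < c) (x ^+ i.+1 * y ^+ h i - x ^+ i * y ^+ h i).
  (* [1 - x ^+ c] is expanded back into a geometric sum so that both sides agree column by
     column. *)
  rewrite -[1 - x ^+ _](geom x 0) // !mulr_sumr -big_split.
  apply: eq_bigr => i _; rewrite -mulr_sumr exprS.
  transitivity ((1 - x) * x ^+ i * ((1 - y) * \sum_(0 <= j < h i) y ^+ j)).
    by ring.
  by rewrite geom //=; ring.
have right_sum : (1 - x) * (1 - y)
      * (\sum_(0 <= j < r) \sum_(c <= i < w j) x ^+ i * y ^+ j)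
    = x ^+ c * (1 - y ^+ r)
      + \sum_(0 <= j < r) (x ^+ w j * y ^+ j.+1 - x ^+ w j * y ^+ j).
  rewrite -[1 - y ^+ _](geom y 0) // !mulr_sumr -big_split.
  rewrite !big_nat; apply: eq_bigr => j /andP[_ jr].
  rewrite -mulr_suml exprS.
  transitivity ((1 - y) * y ^+ j * ((1 - x) * \sum_(c <= i < w j) x ^+ i)).
    by ring.
  by rewrite geom ?cw //=; ring.
have -> : 1 - x - y + x * y = (1 - x) * (1 - y) by ring.
by rewrite mulrDr left_sum right_sum; ring.
Qed.

Section AddBox.
Variables (D : {fset nat * nat}) (p : nat * nat).
Hypotheses (downD : downset D) (downD' : downset (p |` D)) (pD : p \notin D).

Lemma left_mem i : (i < p.1)%N -> (i, p.2) \in D.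
Proof.
move=> ip; have := downD' (x := (i, p.2)) (y := p) (ltnW ip) (leqnn _).
rewrite !inE eqxx => /(_ isT) /orP[/eqP E|//].
by rewrite -E ltnn in ip.
Qed.

Lemma below_mem j : (j < p.2)%N -> (p.1, j) \in D.
Proof.
move=> jp; have := downD' (x := (p.1, j)) (y := p) (leqnn _) (ltnW jp).
rewrite !inE eqxx => /(_ isT) /orP[/eqP E|//].
by rewrite -E ltnn in jp.
Qed.

(** All boxes left of [p] are in [D] and [p] is not, so its row stops exactly there. *)
Lemma width_corner : width D p.2 = p.1.
Proof.
apply/eqP; rewrite eqn_leq leqNgt -mem_width // -surjective_pairing pD /=.
by rewrite leqNgt; apply/negP => /left_mem; rewrite mem_width // ltnn.
Qed.

Lemma height_corner : height D p.1 = p.2.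
Proof.
apply/eqP; rewrite eqn_leq leqNgt -mem_height // -surjective_pairing pD /=.
by rewrite leqNgt; apply/negP => /below_mem; rewrite mem_height // ltnn.
Qed.

Lemma height_gt i : (i < p.1)%N -> (p.2 < height D i)%N.
Proof. by move/left_mem; rewrite mem_height. Qed.

Lemma width_gt j : (j < p.2)%N -> (p.1 < width D j)%N.
Proof. by move/below_mem; rewrite mem_width. Qed.

Lemma big_row (R : Type) (idx : R) (op : Monoid.com_law idx)
    (F : nat * nat -> R) :
  \big[op/idx]_(x <- D | x.2 == p.2) F x
    = \big[op/idx]_(0 <= i < p.1) F (i, p.2).
Proof.
rewrite (@big_fset_cond_seq _ _ _ _ _ _ [seq (i, p.2) | i <- iota 0 p.1]).
- by rewrite big_map /index_iota subn0.
- by rewrite map_inj_uniq ?iota_uniq // => k l [].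
case=> k l /=; rewrite mem_width //; apply/mapP/andP => [[k' + [-> ->]]|[+ /eqP E]].
  by rewrite mem_iota /= width_corner eqxx.
by rewrite E => lt_c; exists k => //; rewrite mem_iota -width_corner.
Qed.

Lemma big_col (R : Type) (idx : R) (op : Monoid.com_law idx)
    (F : nat * nat -> R) :
  \big[op/idx]_(x <- D | x.1 == p.1) F x
    = \big[op/idx]_(0 <= j < p.2) F (p.1, j).
Proof.
rewrite (@big_fset_cond_seq _ _ _ _ _ _ [seq (p.1, j) | j <- iota 0 p.2]).
- by rewrite big_map /index_iota subn0.
- by rewrite map_inj_uniq ?iota_uniq // => k l [].
case=> k l /=; rewrite mem_height //; apply/mapP/andP => [[k' + [-> ->]]|[+ /eqP E]].
  by rewrite mem_iota /= height_corner eqxx.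
by rewrite E => lt_c; exists l => //; rewrite mem_iota -height_corner.
Qed.

Lemma big_left (R : Type) (idx : R) (op : Monoid.com_law idx)
    (F : nat * nat -> R) :
  \big[op/idx]_(x <- D | (x.1 < p.1)%N) F x
    = \big[op/idx]_(0 <= i < p.1) \big[op/idx]_(0 <= j < height D i) F (i, j).
Proof.
rewrite (@big_fset_cond_seq _ _ _ _ _ _
  [seq (i, j) | i <- index_iota 0 p.1, j <- index_iota 0 (height D i)]).
- by rewrite big_allpairs_dep.
- apply: allpairs_uniq_dep => [|i _|]; rewrite ?iota_uniq //.
  by move=> [i j] [k l] _ _ /= [-> ->].
case=> k l /=; rewrite mem_height //.
apply/allpairsPdep/andP => [[i [j [+ + [-> ->]]]]|[lh kp]].
  by rewrite !mem_index_iota.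
by exists k, l; rewrite !mem_index_iota.
Qed.

Lemma big_right (R : Type) (idx : R) (op : Monoid.com_law idx)
    (F : nat * nat -> R) :
  \big[op/idx]_(x <- D | ~~ (x.1 < p.1)%N) F x
    = \big[op/idx]_(0 <= j < p.2) \big[op/idx]_(p.1 <= i < width D j) F (i, j).
Proof.
rewrite (@big_fset_cond_seq _ _ _ _ _ _
  [seq (i, j) | j <- index_iota 0 p.2, i <- index_iota p.1 (width D j)]).
- by rewrite big_allpairs_dep.
- apply: allpairs_uniq_dep => [|i _|]; rewrite ?iota_uniq //.
  by move=> [i j] [k l] _ _ /= [-> ->].
case=> k l /=; rewrite -leqNgt.
apply/allpairsPdep/andP => [[j [i [+ + [-> ->]]]]|[klD pk]].
  by rewrite !mem_index_iota mem_width // => _ /andP[].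
exists l, k; rewrite !mem_index_iota -mem_width // klD pk; split=> //=.
(* A box of [D] weakly right of and weakly above [p] would force [p] into [D]. *)
rewrite ltnNge; apply: contra pD => pl.
by rewrite [p]surjective_pairing; apply: downD klD.
Qed.

(* [m i j] plays the role of the monomial q^i t^j. *)
Lemma corner_identity (R : comNzRingType) (m : int -> int -> R) :
    m 0 0 = 1 -> (forall i j k l, m i j * m k l = m (i + k) (j + l)) ->
  (1 - m 1 0 - m 0 1 + m 1 0 * m 0 1) * (\sum_(x <- D) m x.1 x.2)
    * m (- p.1%:Z) (- p.2%:Z)
  = m (- p.1%:Z) (- p.2%:Z) - m 0 0
    + \sum_(0 <= i < p.1)
        (m (i.+1%:Z - p.1%:Z) ((height D i)%:Z - p.2%:Z)
         - m (i%:Z - p.1%:Z) ((height D i)%:Z - p.2%:Z))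
    + \sum_(0 <= j < p.2)
        (m ((width D j)%:Z - p.1%:Z) (j.+1%:Z - p.2%:Z)
         - m ((width D j)%:Z - p.1%:Z) (j%:Z - p.2%:Z)).
Proof.
move=> m0 mM.
have mX i j n : m i j ^+ n = m (i *+ n) (j *+ n).
  by elim: n => [|n IHn]; rewrite ?m0 // exprS IHn mM !mulrS.
have m_nat (i j : nat) : m i j = m 1 0 ^+ i * m 0 1 ^+ j.
  by rewrite !mX mM !mul0rn add0r addr0 !pmulrn !intz.
(* Cutting at column [p.1] produces the two regions of [geometric_cells]. *)
rewrite (bigID (fun x => (x.1 < p.1)%N)) /= big_left big_right.
have -> : \sum_(0 <= i < p.1) \sum_(0 <= j < height D i) m i j
        = \sum_(0 <= i < p.1) \sum_(0 <= j < height D i) m 1 0 ^+ i * m 0 1 ^+ j.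
  by apply: eq_bigr => i _; apply: eq_bigr => j _.
have -> : \sum_(0 <= j < p.2) \sum_(p.1 <= i < width D j) m i j
        = \sum_(0 <= j < p.2) \sum_(p.1 <= i < width D j) m 1 0 ^+ i * m 0 1 ^+ j.
  by apply: eq_bigr => j _; apply: eq_bigr => i _.
rewrite geometric_cells => [|j /width_gt/ltnW //].
(* The shift turns the monomial at [p] into the constant [m 0 0]. *)
rewrite 2!mulrDl mulrBl mul1r !mulr_suml -m_nat mM !subrr.
by congr (_ + _ + _); apply: eq_bigr => i _; rewrite -!m_nat mulrBl !mM.
Qed.

End AddBox.

(** * Adding a box *)

Definition hook_q (D : {fset nat * nat}) (x : nat * nat) : Qqt :=
  1 - q ^ (1 + (arm D x)%:Z) * t ^ (- (leg D x)%:Z).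

Definition hook_t (D : {fset nat * nat}) (x : nat * nat) : Qqt :=
  1 - q ^ (- (arm D x)%:Z) * t ^ (1 + (leg D x)%:Z).

Definition hook_prod (D : {fset nat * nat}) : Qqt :=
  \prod_(x <- D) (hook_q D x * hook_t D x).

Lemma hook_q_neq0 D x : hook_q D x != 0.
Proof. by apply: (@qt_factor_neq0 (_, _)); rewrite -pair_eqE /=; lia. Qed.

Lemma hook_t_neq0 D x : hook_t D x != 0.
Proof. by apply: (@qt_factor_neq0 (_, _)); rewrite -pair_eqE /=; lia. Qed.

Lemma Omega0_1 : Omega0 (lmonom 0 0) = 1.
Proof. by rewrite Omega0_monom. Qed.

Section AddBoxHook.
Variables (D : {fset nat * nat}) (p : nat * nat).
Hypotheses (downD : downset D) (downD' : downset (p |` D)) (pD : p \notin D).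
Let D' := p |` D.

Definition Gamma_factor : Qqt :=
  Omega0 ((1 - lq - lt + lq * lt) * B D * lmonom (- p.1%:Z) (- p.2%:Z)).

(** Column [i] meets the row of [p] in [(i, p.2)]. There 1 + leg is [height D i - p.2] in both
    diagrams, while minus the arm is [i + 1 - p.1] in [D] and [i - p.1] in [D']; the difference of
    monomials becomes a quotient of [hook_t]. Rows below [p] give [hook_q] symmetrically. *)
Lemma Gamma_factorE :
  Gamma_factor = Omega0 (lmonom (- p.1%:Z) (- p.2%:Z))
    * (\prod_(x <- D | x.2 == p.2) (hook_t D x / hook_t D' x))
    * (\prod_(x <- D | x.1 == p.1) (hook_q D x / hook_q D' x)).
Proof.
rewrite /Gamma_factor (corner_identity downD downD' pD lmonom0 lmonomM).
rewrite 3!Omega0D.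
have -> : Omega0 (- lmonom 0 0) = 1 by rewrite Omega0N Omega0_1 invr1.
rewrite mulr1; congr (_ * _ * _).
  rewrite Omega0_sum (big_row downD downD' pD).
  apply: eq_big_nat => i /andP[_ ip].
  have := height_gt downD downD' ip; have wc := width_corner downD downD' pD.
  rewrite /hook_t /D' arm_U1 // leg_U1 //= eqxx ip (gtn_eqF ip).
  rewrite arm_width // leg_height //= wc => ph.
  (* Both exponents of [t] are positive by [height_gt], so neither monomial is constant. *)
  rewrite Omega0D Omega0N !Omega0_monom !ifF; last 2 first.
  - by apply/negbTE; rewrite -pair_eqE /=; lia.
  - by apply/negbTE; rewrite -pair_eqE /=; lia.
  by congr ((1 - q ^ _ * t ^ _) / (1 - q ^ _ * t ^ _)); lia.
rewrite Omega0_sum (big_col downD downD' pD).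
apply: eq_big_nat => j /andP[_ jp].
have := width_gt downD downD' jp; have hc := height_corner downD downD' pD.
rewrite /hook_q /D' arm_U1 // leg_U1 //= eqxx jp (gtn_eqF jp).
rewrite arm_width // leg_height //= hc => pw.
rewrite Omega0D Omega0N !Omega0_monom !ifF; last 2 first.
- by apply/negbTE; rewrite -pair_eqE /=; lia.
- by apply/negbTE; rewrite -pair_eqE /=; lia.
by congr ((1 - q ^ _ * t ^ _) / (1 - q ^ _ * t ^ _)); lia.
Qed.

Definition row_ratio : Qqt :=
  \prod_(x <- D | x.2 == p.2) (hook_q D' x / hook_q D x).

Definition col_ratio : Qqt :=
  \prod_(x <- D | x.1 == p.1) (hook_t D' x / hook_t D x).

Lemma hook_corner : hook_q D' p * hook_t D' p = (1 - q) * (1 - t).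
Proof.
have a0 : arm D' p = 0%N.
  by rewrite /D' arm_U1 // ltnn andbF arm_width //
             (width_corner downD downD' pD); lia.
have l0 : leg D' p = 0%N.
  by rewrite /D' leg_U1 // ltnn andbF leg_height //
             (height_corner downD downD' pD); lia.
by rewrite /hook_q /hook_t a0 l0 !oppr0 !addr0 !expr0z mulr1 mul1r !expr1z.
Qed.

(** Adding [p] alters arms only in its row and legs only in its column, and no box of [D] lies in
    both, so the two corrections do not overlap. *)
Lemma hook_prodU1 :
  hook_prod D' = (1 - q) * (1 - t) * (hook_prod D
    * (\prod_(x <- D | x.2 == p.2)
         (hook_q D' x * hook_t D' x / (hook_q D x * hook_t D x)))
    * (\prod_(x <- D | x.1 == p.1)
         (hook_q D' x * hook_t D' x / (hook_q D x * hook_t D x)))).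
Proof.
rewrite /hook_prod big_fsetU1 // hook_corner; congr (_ * _).
(* Both corrections are extended to all of [D] by factors 1, to compare box by box; hence the
   factors 1 in the three helpers below. *)
rewrite [X in _ = _ * X]big_mkcond [X in _ = _ * X * _]big_mkcond.
rewrite -!big_split /= big_seq [RHS]big_seq.
apply: eq_bigr => x xD.
have f0 := mulf_neq0 (hook_q_neq0 D x) (hook_t_neq0 D x).
have row (F : fieldType) (a b : F) : b != 0 -> a = b * (a / b) * 1.
  by move=> b0; rewrite mulr1 mulrC divfK.
have col (F : fieldType) (a b : F) : b != 0 -> a = b * 1 * (a / b).
  by move=> b0; rewrite mulr1 mulrC divfK.
have off (F : fieldType) (a b : F) : a = b -> a = b * 1 * 1.
  by move=> ->; rewrite !mulr1.
case: eqP => [x2|/eqP/negbTE x2]; case: eqP => [x1|/eqP/negbTE x1].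
- by case/negP: pD; rewrite [p]surjective_pairing -x1 -x2 -surjective_pairing.
- exact: row.
- exact: col.
have aE : arm D' x = arm D x by rewrite arm_U1 // [p.2 == _]eq_sym x2.
have lE : leg D' x = leg D x by rewrite leg_U1 // [p.1 == _]eq_sym x1.
by apply: off; rewrite /hook_q /hook_t aE lE.
Qed.

(** In the row, [Gamma_factor] cancels the [hook_t] half of each change and leaves the [hook_q]
    half, which is [row_ratio]; in the column the roles are exchanged. *)
Lemma hook_step :
  hook_prod D' * Gamma_factor
  = (1 - q) * (1 - t) * Omega0 (lmonom (- p.1%:Z) (- p.2%:Z))
    * (hook_prod D * (row_ratio * col_ratio)).
Proof.
have cancel_t (F : fieldType) (a b c d : F) : b != 0 -> c != 0 -> d != 0 ->
    a * b / (c * d) * (d / b) = a / c.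
  by move=> b0 c0 d0; field; rewrite b0 c0 d0.
have cancel_q (F : fieldType) (a b c d : F) : a != 0 -> c != 0 -> d != 0 ->
    a * b / (c * d) * (c / a) = b / d.
  by move=> a0 c0 d0; field; rewrite a0 c0 d0.
have regroup (F : fieldType) (a h r c o r' c' : F) :
    a * (h * r * c) * (o * r' * c') = a * o * (h * ((r * r') * (c * c'))).
  by ring.
rewrite hook_prodU1 Gamma_factorE regroup -!big_split.
congr (_ * (_ * (_ * _))); apply: eq_bigr => x _.
  exact: cancel_t (hook_t_neq0 _ _) (hook_q_neq0 _ _) (hook_t_neq0 _ _).
exact: cancel_q (hook_q_neq0 _ _) (hook_q_neq0 _ _) (hook_t_neq0 _ _).
Qed.

End AddBoxHook.

(** * Standard tableaux *)

Lemma mem_Young mu i j :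
  ((i, j) \in Young mu) = (j < size mu)%N && (i < nth 0%N mu j)%N.
Proof.
rewrite inE /=; apply/allpairsPdep/andP => [[l [k [+ + [-> ->]]]]|[jm ij]].
  by rewrite !mem_iota.
by exists j, i; rewrite !mem_iota.
Qed.

Lemma mem_fset_cond (K : choiceType) (A : {fset K}) (P : pred K) x :
  (x \in [fset y in A | P y]) = (x \in A) && P x.
Proof. by rewrite in_fset. Qed.

Lemma mem_subshape mu s k x :
  (x \in subshape mu s k) = (x \in Young mu) && (s x <= k)%N.
Proof. exact: mem_fset_cond. Qed.

Section StandardTableau.
Variables (n : nat) (mu : seq nat) (s : nat * nat -> nat).
Hypotheses (hmu : is_partition n mu) (hs : standard_tableau n mu s).

Lemma downset_Young : downset (Young mu).
Proof.
have /and3P[mu_sorted _ _] := hmu.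
move=> [i' j'] [i j] /= ii' jj'; rewrite !mem_Young => /andP[jm ij].
have j'm := leq_ltn_trans jj' jm; rewrite j'm /=.
apply: leq_ltn_trans ii' (leq_trans ij _).
have geq_trans : transitive geq by move=> a b c /= ba ac; apply: leq_trans ac ba.
exact: (sorted_leq_nth geq_trans leqnn 0%N mu_sorted j' j j'm jm jj').
Qed.

(** Entries increase from [(i', j')] along the row to [(i, j')], then up the column to [(i, j)]; the
    intermediate box lies in the diagram because that is a downset. *)
Lemma downset_subshape k : downset (subshape mu s k).
Proof.
have [_ _ rows cols] := hs.
move=> [i' j'] [i j] /= ii' jj'; rewrite !mem_subshape => /andP[ijY sk].
have ij'Y : (i, j') \in Young mu by exact: downset_Young ijY.
have i'j'Y : (i', j') \in Young mu by exact: downset_Young ijY.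
rewrite i'j'Y /=; apply: leq_trans sk; apply: (@leq_trans (s (i, j'))).
  by move: ii'; rewrite leq_eqVlt => /orP[/eqP->//|ii']; apply/ltnW/rows.
by move: jj'; rewrite leq_eqVlt => /orP[/eqP->//|jj']; apply/ltnW/cols.
Qed.

Lemma tableau_range x : x \in Young mu -> (0 < s x <= n)%N.
Proof.
move=> xY; have [_ im _ _] := hs.
have : s x \in [fset s y | y in Young mu] by apply: in_imfset.
by rewrite im inE /= mem_iota.
Qed.

Lemma subshape0 : subshape mu s 0 = fset0.
Proof.
apply/fsetP => x; rewrite mem_subshape in_fset0; apply/negP => /andP[/tableau_range].
by rewrite leqn0 => /andP[+ _] /eqP s0; rewrite s0.
Qed.

Lemma subshape_full : subshape mu s n = Young mu.
Proof.
apply/fsetP => x; rewrite mem_subshape.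
by apply: andb_idr => /tableau_range/andP[].
Qed.

(** Every such [k] is an entry of the tableau, so the filtered list is nonempty and the default of
    [head] is never returned. *)
Lemma box_ofP k : (0 < k <= n)%N ->
  box_of mu s k \in Young mu /\ s (box_of mu s k) = k.
Proof.
move=> kn; have [_ im _ _] := hs.
have : k \in [fset s y | y in Young mu] by rewrite im inE /= mem_iota.
case/imfsetP => x /= xY kx.
suff : box_of mu s k \in [seq x <- Young mu | s x == k].
  by rewrite mem_filter => /andP[/eqP ? ?].
have : x \in [seq x <- Young mu | s x == k] by rewrite mem_filter -kx eqxx.
by rewrite /box_of; case: [seq _ <- _ | _] => //= y r _; rewrite mem_head.
Qed.

Lemma subshapeS k : (k < n)%N ->
  subshape mu s k.+1 = box_of mu s k.+1 |` subshape mu s k.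
Proof.
move=> kn; have [pY sp] := @box_ofP k.+1 kn; have [s_inj _ _ _] := hs.
apply/fsetP => x; rewrite in_fset1U !mem_subshape leq_eqVlt ltnS andb_orr.
congr (_ || _); apply/andP/eqP => [[xY /eqP sx]|->].
  by apply: s_inj; rewrite ?sx.
by rewrite sp.
Qed.

Lemma box_of_notin k : (k < n)%N -> box_of mu s k.+1 \notin subshape mu s k.
Proof.
by move=> kn; have [_ sp] := @box_ofP k.+1 kn; rewrite mem_subshape sp ltnn andbF.
Qed.

(** Removing the new box from its row or column leaves exactly the boxes of the previous shape
    there. *)
Lemma c_coefS k : (k < n)%N ->
  c_coef mu s k.+1 = row_ratio (subshape mu s k) (box_of mu s k.+1)
                     * col_ratio (subshape mu s k) (box_of mu s k.+1).
Proof.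
move=> kn; have pD := box_of_notin kn; rewrite /c_coef /=.
set p := box_of mu s k.+1 in pD *; set D := subshape mu s k in pD *.
have rowE : row_boxes mu s k.+1 = [fset x in D | x.2 == p.2].
  apply/fsetP => x; rewrite [LHS]mem_fset_cond [RHS]mem_fset_cond.
  rewrite subshapeS // in_fset1U -/p -/D.
  by case: (eqVneq x p) => [->|_] /=; rewrite ?andbF ?andbT // (negbTE pD).
have colE : col_boxes mu s k.+1 = [fset x in D | x.1 == p.1].
  apply/fsetP => x; rewrite [LHS]mem_fset_cond [RHS]mem_fset_cond.
  rewrite subshapeS // in_fset1U -/p -/D.
  by case: (eqVneq x p) => [->|_] /=; rewrite ?andbF ?andbT // (negbTE pD).
by rewrite rowE colE -!big_fset_condE subshapeS.
Qed.

(** The identity at every stage, cleared of denominators; induction on [k] multiplies in [hook_step]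
    for the box added. *)
Lemma hook_prod_Gamma k : (k <= n)%N ->
  hook_prod (subshape mu s k) * Gamma mu s k
  = (1 - q) ^+ k * (1 - t) ^+ k * Omega0 (linv (B (subshape mu s k)))
    * \prod_(1 <= i < k.+1) c_coef mu s i.
Proof.
elim: k => [_|k IHk kn].
  rewrite subshape0 /hook_prod /Gamma /B !big_seq_fset0.
  by rewrite linv0 Omega0_0 !mulr1.
have pD := box_of_notin kn; have downD := @downset_subshape k.
have downD' := @downset_subshape k.+1; rewrite subshapeS // in downD' *.
have step := hook_step downD downD' pD.
have linvS : linv (B (box_of mu s k.+1 |` subshape mu s k))
  = lmonom (- (box_of mu s k.+1).1%:Z) (- (box_of mu s k.+1).2%:Z)
    + linv (B (subshape mu s k)).
  by rewrite /B big_fsetU1 // linvD linv_monom.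
have GammaS : Gamma mu s k.+1
    = Gamma mu s k * Gamma_factor (subshape mu s k) (box_of mu s k.+1).
  by rewrite /Gamma big_nat_recr.
have prodS : \prod_(1 <= i < k.+2) c_coef mu s i
    = \prod_(1 <= i < k.+1) c_coef mu s i * c_coef mu s k.+1.
  by rewrite big_nat_recr.
rewrite GammaS prodS (c_coefS kn) linvS Omega0D.
(* [h], the hook product of the smaller shape, is substituted by the induction hypothesis rather
   than cancelled. *)
have combine (F : fieldType) (h' g f h o w c d a b a' b' : F) :
    h' * f = a * b * o * (h * d) -> h * g = a' * b' * w * c ->
    h' * (g * f) = a * a' * (b * b') * (o * w) * (c * d).
  move=> h'f hg; transitivity (h' * f * g); first by ring.
  rewrite h'f.
  transitivity (a * b * o * d * (h * g)); first by ring.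
  by rewrite hg; ring.
by rewrite !exprS; apply: combine step (IHk (ltnW kn)).
Qed.

End StandardTableau.

Theorem proposition4p8p2 (n : nat) (mu : seq nat) (s : nat * nat -> nat)
    (hmu : is_partition n mu) (hs : standard_tableau n mu s) :
  (\prod_(x <- Young mu)
     ((1 - q ^ (1 + (arm (Young mu) x)%:Z) * t ^ (- (leg (Young mu) x)%:Z))
      * (1 - q ^ (- (arm (Young mu) x)%:Z) * t ^ (1 + (leg (Young mu) x)%:Z))))
  / ((1 - q) ^+ n * (1 - t) ^+ n * Omega0 (linv (B (Young mu))))
  * Gamma mu s n
  = \prod_(1 <= k < n.+1) c_coef mu s k.
Proof.
have q1 : 1 - q != 0 by have := @qt_factor_neq0 (1, 0) isT; rewrite /qt mulr1.
have t1 : 1 - t != 0 by have := @qt_factor_neq0 (0, 1) isT; rewrite /qt mul1r.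
have solve (F : fieldType) (h d g c : F) : d != 0 -> h * g = d * c -> h / d * g = c.
  by move=> d0 hg; apply: (mulfI d0); rewrite -hg; field.
apply: solve.
  apply: mulf_neq0 (Omega0_neq0 _).
  exact: mulf_neq0 (expf_neq0 _ q1) (expf_neq0 _ t1).
(* The whole diagram is the stage [k = n]. *)
by rewrite -(subshape_full hs); exact: hook_prod_Gamma hmu hs _ (leqnn n).
Qed.
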